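(* Let $n,m\ge1$, $\mathbf{x}=(x_1,\ldots,x_n)$, $\mathbf{z}=(z_1,\ldots,z_m)$. For a partition $\lambda$ let $$g_\lambda(\mathbf{x};\mathbf{z})=\sum_{\mathrm{sh}(\pi)=\lambda}\ \prod_{(i,j)\in\mathrm{Des}(\pi)}x_i z_{\pi_{ij}},$$ where the sum runs over plane partitions $\pi\in\mathrm{PP}(\infty,n,m)$ of shape $\lambda$. These polynomials satisfy the following properties. (i) For $\ell(\lambda)\le n$, $g_\lambda(\mathbf{x};\mathbf{z})=\mathbf{x}^\lambda s_\lambda(\mathbf{z})+\text{(terms of lower degree)}$, where $\mathbf{x}^\lambda=x_1^{\lambda_1}\cdots x_n^{\lambda_n}$ and $s_\lambda$ is the Schur polynomial. Moreover, each monomial $\mathbf{x}^\alpha\mathbf{z}^\beta$ occurring in $g_\lambda(\mathbf{x};\mathbf{z})$ has $|\alpha|=|\beta|$. (ii) $$g_\lambda(\mathbf{x};\mathbf{z})=\sum_{\mathrm{sh}(\pi)=\lambda}\ \prod_{i=1}^{n}x_i^{d_i(\pi)}\prod_{j=1}^{m}z_j^{c_j(\pi)},$$ where the sum runs over plane partitions $\pi\in\mathrm{PP}(\infty,n,m)$ of shape $\lambda$, $c_j(\pi)$ is the number of columns of $\pi$ containing $j$, and $d_i(\pi)$ is the number of entries in the $i$th row of $\pi$ that are strictly larger than the entry below. (iii) For $\ell(\lambda)\le n$, $g_\lambda(1^n;\mathbf{z})=g_\lambda(\mathbf{z})$, the dual symmetric Grothendieck polynomial, where $1^n=(1,\ldots,1)$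 ($n$ times). (iv) The following Cauchy-type identity holds (as formal power series): $$\sum_{\ell(\lambda)\le n}g_\lambda(\mathbf{x};\mathbf{z})=\prod_{i=1}^{n}\prod_{j=1}^{m}\frac{1}{1-x_i z_j},$$ where the sum is over all partitions $\lambda$ with at most $n$ parts.
   Context: A plane partition $\pi=(\pi_{ij})_{i,j\ge1}$ is a two-dimensional array of nonnegative integers with finitely many nonzero entries such that $\pi_{ij}\ge\pi_{i+1\,j}$ and $\pi_{ij}\ge\pi_{i\,j+1}$ for all $i,j$ ($i$ is the row index, $j$ the column index). Zero entries are ignored (not regarded as entries of $\pi$). Its shape $\mathrm{sh}(\pi)$ is the partition whose Young diagram is $\{(i,j):\pi_{ij}>0\}$. $\mathrm{PP}(\infty,n,m)$ is the set of plane partitions with at most $n$ nonzero rows and all entries at most $m$ (the number of columns is not restricted). $\mathrm{Des}(\pi)=\{(i,j):\pi_{ij}>\pi_{i+1\,j}\}$. $\ell(\lambda)$ is the number of (positive) parts of $\lambda$, with $\lambda_i=0$ for $i>\ell(\lambda)$. The Schur polynomial is $s_\lambda(z_1,\ldots,z_m)=\sum_\pi\prod_{i=1}^m z_i^{a_i(\pi)}$, the sum over column-strict plane partitions $\pi$ of shape $\lambda$ (that is, $\pi_{ij}>\pi_{i+1\,j}$ for every cell $(i,j)$ of $\lambda$) with largest entry at most $m$, where $a_i(\pi)$ is the number of entries $i$ in $\pi$. The dual symmetric Grothendieck polynomial is $g_\lambda(z_1,\ldots,z_m)=\sum_{\mathrm{sh}(\pi)=\lambda}\prod_{i=1}^m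 z_i^{c_i(\pi)}$, the sum over plane partitions $\pi$ of shape $\lambda$ with largest entry at most $m$, where $c_i(\pi)$ is the number of columns of $\pi$ containing $i$. *)

(* Defs.v *)
From HB Require Import structures.
From mathcomp Require Import all_boot all_order all_algebra.
From mathcomp.multinomials Require Import mpoly.

Set Implicit Arguments.
Unset Strict Implicit.
Unset Printing Implicit Defensive.

Import Order.TTheory GRing.Theory Num.Theory.
Local Open Scope ring_scope.

(* Partitions: [l(lambda) = size lambda], [|lambda| = sumn lambda], and the   *)
(* (i+1)-st part is [nth 0 lambda i], which is 0 beyond the length. All row   *)
(* and column indices below start at 0.                                       *)
Definition is_partition (la : seq nat) : bool :=
  sorted geq la && (0%N \notin la).

Definition plane_partition (p : nat -> nat -> nat) : Prop :=
  [/\ forall i j, (p i.+1 j <= p i j)%N,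
      forall i j, (p i j.+1 <= p i j)%N
    & exists N, forall i j, (N <= i)%N || (N <= j)%N -> p i j = 0%N].

Definition has_shape (p : nat -> nat -> nat) (la : seq nat) : Prop :=
  forall i j, (0 < p i j)%N = (j < nth 0%N la i)%N.

(* To sum over plane partitions, those with at most r nonzero rows, at most   *)
(* c nonzero columns and entries at most m are encoded by their restriction   *)
(* to an r x c box; [entry] extends such an array by zeros. The lemmas        *)
(* [pp_of_shapeP] and [pp_of_shape_complete] show that nothing is lost.       *)
Definition array (r c m : nat) := {ffun 'I_r * 'I_c -> 'I_m.+1}.

Definition entry (r c m : nat) (p : array r c m) (i j : nat) : nat :=
  match insub i : option 'I_r, insub j : option 'I_c with
  | Some a, Some b => p (a, b)
  | _, _ => 0%N
  end.

Definition pp_of_shape (la : seq nat) (r c m : nat) (p : array r c m) : bool :=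
  [&& [forall a : 'I_r, forall b : 'I_c,
         (entry p a.+1 b <= entry p a b)%N && (entry p a b.+1 <= entry p a b)%N],
      (size la <= r)%N, (head 0%N la <= c)%N
    & [forall a : 'I_r, forall b : 'I_c,
         (0 < entry p a b)%N == (b < nth 0%N la a)%N]].

Definition column_strict (r c m : nat) (p : array r c m) : bool :=
  [forall a : 'I_r, forall b : 'I_c,
     (0 < entry p a b)%N ==> (entry p a.+1 b < entry p a b)%N].

Definition Des (r c m : nat) (p : array r c m) : {set 'I_r * 'I_c} :=
  [set u : 'I_r * 'I_c | (entry p u.1.+1 u.2 < entry p u.1 u.2)%N].

(* The index k : 'I_m stands for the entry k + 1 of a plane partition. *)
Definition mult_entry (r c m : nat) (p : array r c m) (k : 'I_m) : nat :=
  #|[set u : 'I_r * 'I_c | p u == k.+1 :> nat]|.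

Definition cols_containing (r c m : nat) (p : array r c m) (k : 'I_m) : nat :=
  #|[set b : 'I_c | [exists a : 'I_r, p (a, b) == k.+1 :> nat]]|.

Definition row_descents (r c m : nat) (p : array r c m) (a : 'I_r) : nat :=
  #|[set b : 'I_c | (entry p a.+1 b < entry p a b)%N]|.

(* In n + m variables, the first n are the x's and the last m are the z's. *)
Definition xvar (n m : nat) (i : 'I_n) : {mpoly int[n + m]} := 'X_(lshift m i).

Definition zvar (n m : nat) (j : 'I_m) : {mpoly int[n + m]} := 'X_(rshift n j).

(* The variable z_v for an entry v : {0, .., m}; the value at v = 0 is a      *)
(* dummy, since an entry at a descent is positive.                            *)
Definition zentry (n m : nat) (v : 'I_m.+1) : {mpoly int[n + m]} :=
  if unlift ord0 v is Some j then zvar n j else 1.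

(* A plane partition of shape la has exactly [head 0 la] nonzero columns, so  *)
(* the bound on the number of columns is no restriction in the sums below.    *)
Definition g_xz (n m : nat) (la : seq nat) : {mpoly int[n + m]} :=
  \sum_(p : array n (head 0%N la) m | pp_of_shape la p)
    \prod_(u in Des p) (xvar m u.1 * zentry n (p u)).

Definition schur (m : nat) (la : seq nat) : {mpoly int[m]} :=
  \sum_(p : array (size la) (head 0%N la) m
          | pp_of_shape la p && column_strict p)
    \prod_(k < m) 'X_k ^+ mult_entry p k.

Definition dual_grothendieck (m : nat) (la : seq nat) : {mpoly int[m]} :=
  \sum_(p : array (size la) (head 0%N la) m | pp_of_shape la p)
    \prod_(k < m) 'X_k ^+ cols_containing p k.

Definition in_z (n m : nat) (p : {mpoly int[m]}) : {mpoly int[n + m]} :=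
  p \mPo [tuple zvar n j | j < m].

Definition set_x_1 (n m : nat) (p : {mpoly int[n + m]}) : {mpoly int[m]} :=
  p \mPo [tuple match split i with inl _ => 1 | inr j => 'X_j end | i < n + m].

(* Formal power series over int in k variables, as coefficient functions. *)
Definition fps (k : nat) := 'X_{1..k} -> int.

Definition fps_of (k : nat) (p : {mpoly int[k]}) : fps k := fun mon => p@_mon.

Definition fps_one (k : nat) : fps k := fun mon => (mon == 0%MM)%:R.
Arguments fps_one : clear implicits.

Definition fps_sub (k : nat) (f g : fps k) : fps k := fun mon => f mon - g mon.

Definition fps_mul (k : nat) (f g : fps k) : fps k := fun mon =>
  \sum_(u : 'X_{1..k < (mdeg mon).+1, (mdeg mon).+1}
          | mon == (u.1 + u.2)%MM) f u.1 * g u.2.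

Definition fps_exp (k : nat) (f : fps k) (e : nat) : fps k :=
  iter e (fps_mul f) (fps_one k).

(* 1 / f = sum_e (1 - f)^e when f has constant coefficient 1, a locally       *)
(* finite sum: (1 - f)^e has no monomial of degree < e (see [fps_mulV]).      *)
Definition fps_inv (k : nat) (f : fps k) : fps k := fun mon =>
  \sum_(e < (mdeg mon).+1) fps_exp (fps_sub (fps_one k) f) e mon.

(* [S] is the sum of the locally finite family [F i], i ranging over [P]. *)
Definition fps_is_sum (k : nat) (I : eqType) (P : pred I) (F : I -> fps k)
    (S : fps k) : Prop :=
  forall mon, exists s : seq I,
    [/\ uniq s, all P s, forall i, P i -> F i mon != 0 -> i \in s
      & S mon = \sum_(i <- s) F i mon].

Lemma entryE (r c m : nat) (p : array r c m) (a : 'I_r) (b : 'I_c) :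
  entry p a b = p (a, b).
Proof. by rewrite /entry !valK. Qed.

Lemma entry_out (r c m : nat) (p : array r c m) (i j : nat) :
  (r <= i)%N || (c <= j)%N -> entry p i j = 0%N.
Proof.
rewrite /entry => /orP[] h; first by rewrite insubF // ltnNge h.
by case: insub => // a; rewrite insubF // ltnNge h.
Qed.

Lemma entry_le (r c m : nat) (p : array r c m) (i j : nat) :
  (entry p i j <= m)%N.
Proof.
rewrite /entry; case: insub => // a; case: insub => // b.
by rewrite -ltnS.
Qed.

Lemma part_head (la : seq nat) (i : nat) :
  is_partition la -> (nth 0%N la i <= head 0%N la)%N.
Proof.
case/andP=> sla _; case: (ltnP i (size la)) => hi; last by rewrite nth_default.
rewrite -nth0.
have geqT : transitive geq by move=> a b d /= ab bd; apply: leq_trans bd ab.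
by apply: (sorted_leq_nth geqT leqnn 0%N sla) => //;
  rewrite inE (leq_ltn_trans _ hi).
Qed.

Lemma part_gt0 (la : seq nat) (i : nat) :
  is_partition la -> (0 < nth 0%N la i)%N = (i < size la)%N.
Proof.
case/andP=> _ n0; case: (ltnP i (size la)) => hi; last by rewrite nth_default.
by rewrite lt0n; apply: contraNneq n0 => <-; apply: mem_nth.
Qed.

Lemma pp_of_shapeP (la : seq nat) (r c m : nat) (p : array r c m) :
  is_partition la ->
  reflect (plane_partition (entry p) /\ has_shape (entry p) la)
          (pp_of_shape la p).
Proof.
move=> Pla; apply: (iffP and4P) => [[mono sr sc sh]|[[m1 m2 _] sh]].
  have M i j : (entry p i.+1 j <= entry p i j)%N
            && (entry p i j.+1 <= entry p i j)%N.
    case: (ltnP i r) => hi; last by rewrite !entry_out ?hi ?(leqW hi).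
    case: (ltnP j c) => hj; last by rewrite !entry_out ?hj ?(leqW hj) ?orbT.
    by move/forallP/(_ (Ordinal hi))/forallP/(_ (Ordinal hj)): mono.
  split; first split.
  - by move=> i j; case/andP: (M i j).
  - by move=> i j; case/andP: (M i j).
  - exists (maxn r c) => i j h; apply: entry_out.
    by case/orP: h; rewrite geq_max => /andP[h1 h2]; rewrite ?h1 ?h2 ?orbT.
  move=> i j; case: (ltnP i r) => hi; last first.
    by rewrite entry_out ?hi // nth_default // (leq_trans sr).
  case: (ltnP j c) => hj; last first.
    rewrite entry_out ?hj ?orbT //; apply/esym/negbTE; rewrite -leqNgt.
    by apply: leq_trans (part_head i Pla) (leq_trans sc hj).
  by move/forallP/(_ (Ordinal hi))/forallP/(_ (Ordinal hj))/eqP: sh.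
split.
- by apply/forallP=> a; apply/forallP=> b; rewrite m1 m2.
- rewrite leqNgt -part_gt0 // -sh entry_out ?leqnn //.
- by rewrite leqNgt -nth0 -sh entry_out ?leqnn ?orbT.
- by apply/forallP=> a; apply/forallP=> b; rewrite sh.
Qed.

(* Each plane partition in PP(infinity, n, m) of shape la is encoded by       *)
(* exactly one array.                                                         *)
Lemma pp_of_shape_complete (n m : nat) (la : seq nat) (q : nat -> nat -> nat) :
  is_partition la -> plane_partition q -> has_shape q la ->
  (forall i j, (n <= i)%N -> q i j = 0%N) -> (forall i j, (q i j <= m)%N) ->
  exists! p : array n (head 0%N la) m, pp_of_shape la p /\ entry p =2 q.
Proof.
move=> Pla Pq Sq qn qm.
pose p : array n (head 0%N la) m := [ffun u : _ * _ => inord (q (val u.1) (val u.2))].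
have pq : entry p =2 q.
  move=> i j; case: (ltnP i n) => hi; last by rewrite entry_out ?hi // qn.
  case: (ltnP j (head 0%N la)) => hj.
    by rewrite (entryE p (Ordinal hi) (Ordinal hj)) ffunE inordK ?ltnS.
  rewrite entry_out ?hj ?orbT //; apply/esym/eqP; rewrite -leqn0 leqNgt Sq.
  by rewrite -leqNgt (leq_trans (part_head i Pla)).
exists p; split; last first.
  move=> p' [_ p'q]; apply/ffunP=> -[a b]; apply/val_inj.
  by rewrite /= -!entryE pq p'q.
split=> //; apply/pp_of_shapeP => //; split; last by move=> i j; rewrite pq.
case: Pq => q1 q2 [N qN].
split=> [i j|i j|]; rewrite ?pq //.
by exists N => i j h; rewrite pq qN.
Qed.

Lemma fps_of1 (k : nat) : fps_of (1 : {mpoly int[k]}) =1 fps_one k.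
Proof. by move=> mon; rewrite /fps_of mcoeff1. Qed.

Lemma fps_ofM (k : nat) (p q : {mpoly int[k]}) :
  fps_of (p * q) =1 fps_mul (fps_of p) (fps_of q).
Proof. by move=> mon; apply: mcoeffM. Qed.

Lemma fps_exp_low (k : nat) (t : fps k) (e : nat) (mon : 'X_{1..k}) :
  t 0%MM = 0 -> (mdeg mon < e)%N -> fps_exp t e mon = 0.
Proof.
move=> t0; elim: e mon => // e IH mon lt_e.
rewrite /fps_exp /= -/(fps_exp t e) /fps_mul big1 // => u /eqP Eu.
case: (eqVneq (val u.1) 0%MM) => [->|nz]; first by rewrite t0 mul0r.
have E := congr1 (@mdeg k) Eu; rewrite mdegD in E.
rewrite IH ?mulr0 //; apply: leq_trans (_ : (mdeg mon <= e)%N) => //.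
rewrite [X in (_ <= X)%N]E.
by rewrite -[X in (X < _)%N]add0n ltn_add2r lt0n mdeg_eq0.
Qed.

Lemma fps_mulV (k : nat) (f : fps k) :
  f 0%MM = 1 -> fps_mul f (fps_inv f) =1 fps_one k.
Proof.
move=> f0 mon; set t := fps_sub (fps_one k) f.
have t0 : t 0%MM = 0 by rewrite /t /fps_sub /fps_one eqxx f0 subrr.
pose D := (mdeg mon).+1.
have invE (v : 'X_{1..k}) : (mdeg v < D)%N ->
    fps_inv f v = \sum_(e < D) fps_exp t e v.
  move=> vD; rewrite /fps_inv -/t -!(big_mkord xpredT (fun e => fps_exp t e v)).
  rewrite [RHS](big_cat_nat (n := (mdeg v).+1)) //=.
  rewrite [X in _ = _ + X]big_nat_cond [X in _ = _ + X]big1 ?addr0 //.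
  by move=> e /andP[/andP[le_e _] _]; apply: fps_exp_low.
have fE v : f v = fps_one k v - t v by rewrite /t /fps_sub opprB addrC subrK.
have one_mul g : fps_mul (fps_one k) g mon = g mon.
  pose G : {mpoly int[k]} := \sum_(v : 'X_{1..k < D}) g v *: 'X_[v].
  have GE (v : 'X_{1..k}) : (mdeg v < D)%N -> G@_v = g v.
    move=> vD; rewrite /G raddf_sum /= (bigD1 (BMultinom vD)) //= big1.
      by rewrite mcoeffZ mcoeffX eqxx mulr1 addr0.
    by move=> w /negbTE nw; rewrite mcoeffZ mcoeffX -[v]/(val (BMultinom vD))
      (inj_eq val_inj) nw mulr0.
  rewrite -(GE mon) // -[G]mul1r mcoeffM; apply: eq_bigr => u _.
  by rewrite mcoeff1 GE // bmdeg.
rewrite /fps_mul (eq_bigr (fun u : 'X_{1..k < D, D} =>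
  \sum_(e < D) (fps_one k u.1 * fps_exp t e u.2 - t u.1 * fps_exp t e u.2))).
  rewrite exchange_big /=.
  rewrite (eq_bigr (fun e : 'I_D => fps_exp t e mon - fps_exp t e.+1 mon)).
    rewrite -(big_mkord xpredT (fun e => fps_exp t e mon - fps_exp t e.+1 mon)).
    rewrite -[LHS]opprK -sumrN; under eq_bigr do rewrite opprB.
    by rewrite telescope_sumr // opprB (fps_exp_low (e := D)) // subr0.
  by move=> e _; rewrite sumrB -[X in X - _]/(fps_mul _ _ mon) one_mul.
move=> u _; rewrite invE ?bmdeg // fE mulr_sumr.
by apply: eq_bigr => e _; rewrite mulrBl.
Qed.

(* Main.v *)
(* A matrix w of natural numbers of size n x m is turned into its last        *)
(* passage times G(i, j) = w(i, j) + max (G(i + 1, j), G(i, j + 1)). The      *)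
(* rows of G are partitions, and, with indices from 0, their conjugates        *)
(* pi(i, b) = #{j | b < G(i, j)} are the rows of a plane partition whose      *)
(* shape is the first column of G. The number of descents of value j + 1 in   *)
(* row i is G(i, j) - max (G(i + 1, j), G(i, j + 1)) = w(i, j); thus this     *)
(* is a bijection and the weight of pi is prod (x_i z_j)^w(i, j). Summing     *)
(* over all w gives the Cauchy identity.                                      *)
(* A column of pi that contains j has exactly one descent of value j, which   *)
(* is (ii), and (iii) on setting x = 1. Moreover |alpha| = |beta| = #Des(pi), *)
(* which is at most the number of cells, with equality iff pi is              *)
(* column-strict; this is (i).                                                *)

Require Import Defs.
From mathcomp Require Import all_boot all_order all_algebra.
From mathcomp.multinomials Require Import mpoly.
From mathcomp Require Import zify.

Set Implicit Arguments.
Unset Strict Implicit.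
Unset Printing Implicit Defensive.

Import Order.TTheory GRing.Theory Num.Theory.
Local Open Scope ring_scope.

(** Everything is read off the matrix [des_count p] of descents sorted by row and value. By
    [prod_descents] the weight of a plane partition is the monomial whose x-exponents are the row
    sums and whose z-exponents are the column sums of this matrix; these sums are d_i
    ([row_descentsE]) and c_j ([cols_containingE]). This gives (ii), the balance |alpha| = |beta|,
    and (iii) after a change of box ([sum_resize]). In (i), column-strict plane partitions have d_i
    = lambda_i and produce the top term ([g_xz_top]); the others have lower degree
    ([sum_row_descents_lt]). For (iv), the conjugates of the rows satisfy the last passage recursion
    of this matrix ([row_conjE]). Hence the matrix determines the plane partition ([pp_of_matrixK])
    and every matrix occurs ([matrix_of_ppK]). The identity is compared at one monomial at a time:
    its degree bounds the matrices and shapes that matter, so both sides become the same finite sum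
    over matrices ([sum_mcoeff_g_xz], [cauchy_product_mcoeff]). *)

(** * Counting initial segments and intervals *)

Lemma leq_ltn_imp (x y : nat) : (forall b, b < x -> b < y)%N -> (x <= y)%N.
Proof. by move=> H; rewrite leqNgt; apply/negP => /H; rewrite ltnn. Qed.

Lemma eqn_ltn_ext (x y : nat) : (forall b, (b < x) = (b < y))%N -> x = y.
Proof. by move=> H; apply/eqP; rewrite eqn_leq !leq_ltn_imp // => b; rewrite H. Qed.

(** A down-closed set is an initial segment, so its size exceeds [j] exactly when it contains [j].
    Both conjugations below are handled through this equivalence. *)
Lemma card_downset (m : nat) (Q : pred nat) (j : nat) :
  (forall i, Q i.+1 -> Q i) ->
  (j < #|[set i : 'I_m | Q i]|)%N = (j < m)%N && Q j.
Proof.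
move=> Q_down; have Q_le a b : (a <= b)%N -> Q b -> Q a.
  move=> /subnK <-; elim: (b - a)%N => // d IH Qd; exact: IH (Q_down _ Qd).
have cardE k : #|[set i : 'I_k | Q i]| = (\sum_(i < k) Q i)%N.
  by rewrite -sum1dep_card big_mkcond; apply: eq_bigr => i _; case: (Q i).
rewrite cardE; elim: m => [|m IH]; first by rewrite big_ord0.
rewrite big_ord_recr /=; case Qm: (Q m); last first.
  rewrite addn0 IH ltnS [in RHS]leq_eqVlt.
  by case: (eqVneq j m) => [->|]; rewrite ?Qm ?ltnn ?andbF.
rewrite (_ : (\sum_(i < m) Q i = m)%N); last first.
  rewrite (eq_bigr (fun=> 1%N)) ?sum1_card ?card_ord // => i _.
  by rewrite (Q_le _ _ (ltnW (ltn_ord i)) Qm).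
by rewrite addn1; case: ltnP => //= jm; rewrite (Q_le j m).
Qed.

Lemma card_ord_interval (c x y : nat) :
  #|[set b : 'I_c | (x <= b < y)%N]| = (minn c y - x)%N.
Proof.
rewrite -sum1dep_card big_mkcond /=; elim: c => [|c IH].
  by rewrite big_ord0 min0n.
by rewrite big_ord_recr /= IH; case: ifP; lia.
Qed.

(** * Last passage times of a matrix *)

Section LastPassage.

Variables (n m N : nat) (w : array n m N).

(** Each step raises [i + j] by 1, so the fuel [n + m - (i + j)] given by [lpp] suffices to leave
    the matrix. *)
Fixpoint lpp_fuel (k i j : nat) : nat :=
  if k is k'.+1 then
    (entry w i j + maxn (lpp_fuel k' i.+1 j) (lpp_fuel k' i j.+1))%N
  else 0%N.

(* The maximal sum of entries of [w] along a lattice path that starts at      *)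
(* [(i, j)] and increases one of the two indices by 1 at each step.           *)
Definition lpp (i j : nat) : nat := lpp_fuel (n + m - (i + j)) i j.

Lemma lpp_out i j : (n <= i)%N || (m <= j)%N -> lpp i j = 0%N.
Proof.
rewrite /lpp; move: (_ - _)%N => k; elim: k i j => //= k IH i j ij.
by rewrite entry_out // !IH ?max0n //; lia.
Qed.

Lemma lppE i j :
  lpp i j = (entry w i j + maxn (lpp i.+1 j) (lpp i j.+1))%N.
Proof.
case: (ltnP (i + j) (n + m)) => ij; last first.
  by rewrite !lpp_out ?entry_out //; lia.
rewrite {1}/lpp; case E : (n + m - (i + j))%N => [|k] /=; first by lia.
have E1 : (n + m - (i.+1 + j) = k)%N by lia.
have E2 : (n + m - (i + j.+1) = k)%N by lia.
by rewrite /lpp E1 E2.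
Qed.

Lemma lpp_unique (H : nat -> nat -> nat) :
  (forall i j, (n <= i)%N || (m <= j)%N -> H i j = 0%N) ->
  (forall i j, (i < n)%N -> (j < m)%N ->
     H i j = entry w i j + maxn (H i.+1 j) (H i j.+1))%N ->
  H =2 lpp.
Proof.
move=> H_out H_rec i j; rewrite /lpp; move Ek: (n + m - (i + j))%N => k.
elim: k i j Ek => [|k IH] i j Ek /=; first by rewrite H_out //; lia.
case: (boolP ((n <= i) || (m <= j))%N) => [out|].
  by rewrite H_out // entry_out // -!IH ?H_out //; lia.
by rewrite negb_or -!ltnNge => /andP[i_n j_m]; rewrite H_rec // !IH //; lia.
Qed.

Lemma lpp_rowS i j : (lpp i.+1 j <= lpp i j)%N.
Proof. by rewrite (lppE i j); lia. Qed.

Lemma lpp_colS i j : (lpp i j.+1 <= lpp i j)%N.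
Proof. by rewrite (lppE i j); lia. Qed.

Lemma lpp_le00 i j : (lpp i j <= lpp 0 0)%N.
Proof.
apply: (@leq_trans (lpp i 0)).
  by elim: j => // j IH; apply: leq_trans (lpp_colS i j) IH.
by elim: i => // i IH; apply: leq_trans (lpp_rowS i 0) IH.
Qed.

(** The induction bounds a path from [(i, j)] by the cells on antidiagonals from [i + j] on: the
    later steps use strictly later antidiagonals, so the cell [(i, j)] is counted once. *)
Lemma lpp_le_sum i j : (lpp i j <= \sum_u w u)%N.
Proof.
suff H k : (lpp_fuel k i j
    <= \sum_(u : 'I_n * 'I_m | (i + j <= u.1 + u.2)%N) w u)%N.
  by apply: leq_trans (H _) _; rewrite big_mkcond leq_sum // => u _; case: ifP.
elim: k i j => //= k IH i j.
set S := (\sum_(u : 'I_n * 'I_m | (i + j < u.1 + u.2)%N) w u)%N.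
have IHS : (maxn (lpp_fuel k i.+1 j) (lpp_fuel k i j.+1) <= S)%N.
  by rewrite geq_max (leq_trans (IH _ _)) ?(leq_trans (IH _ _)) ?addnS.
case: (boolP ((n <= i) || (m <= j))%N) => [out|].
  rewrite entry_out // add0n; apply: leq_trans IHS _.
  rewrite /S big_mkcond [leqRHS]big_mkcond leq_sum // => u _.
  by case: ifP => // /ltnW ->.
rewrite negb_or -!ltnNge => /andP[i_n j_m].
rewrite (bigD1 (Ordinal i_n, Ordinal j_m)) //=.
rewrite -(entryE w (Ordinal i_n)) leq_add2l; apply: leq_trans IHS _.
rewrite /S big_mkcond [leqRHS]big_mkcond leq_sum // => u _.
case: ifP => // lt_u; rewrite (ltnW lt_u) /=.
by case: eqP lt_u => //= ->; rewrite ltnn.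
Qed.

End LastPassage.

Definition array_of (r c m : nat) (f : nat -> nat -> nat) : array r c m :=
  [ffun u : 'I_r * 'I_c => inord (f u.1 u.2)].

Lemma entry_array_of r c m (f : nat -> nat -> nat) i j : (f i j <= m)%N ->
  entry (array_of r c m f) i j = if (i < r)%N && (j < c)%N then f i j else 0%N.
Proof.
move=> f_le; case: (ltnP i r) => ir; last by rewrite entry_out ?ir.
case: (ltnP j c) => jc /=; last by rewrite entry_out ?jc ?orbT.
by rewrite (entryE _ (Ordinal ir) (Ordinal jc)) ffunE /= inordK ?ltnS.
Qed.

Lemma entry_inj r c m (p q : array r c m) : entry p =2 entry q -> p = q.
Proof. by move=> pq; apply/ffunP=> -[a b]; apply: val_inj; rewrite /= -!entryE. Qed.

(** * Descents and conjugates of the rows *)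

Section Descents.

Variables (n c m : nat) (p : array n c m).

Definition row_conj (i j : nat) : nat := #|[set b : 'I_c | (j < entry p i b)%N]|.

Definition des_count (i j : nat) : nat :=
  #|[set b : 'I_c | (entry p i b == j.+1) && (entry p i.+1 b < j.+1)%N]|.

Lemma des_count_out i j : (n <= i)%N || (m <= j)%N -> des_count i j = 0%N.
Proof.
move=> ij; apply: eq_card0 => b; rewrite !inE; case: eqP => //= Eb.
by have := entry_le p i b; case/orP: ij => ?; [rewrite entry_out ?ij // in Eb|]; lia.
Qed.

Lemma des_count_le i j : (des_count i j <= c)%N.
Proof. by rewrite -[leqRHS]card_ord max_card. Qed.

Hypothesis p_row : forall i j, (entry p i.+1 j <= entry p i j)%N.
Hypothesis p_col : forall i j, (entry p i j.+1 <= entry p i j)%N.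

Lemma lt_row_conj i j b : (b < row_conj i j)%N = (j < entry p i b)%N.
Proof.
rewrite /row_conj (@card_downset c (fun b => (j < entry p i b)%N)); last first.
  by move=> a /leq_trans; apply.
by case: ltnP => // cb; rewrite entry_out ?cb ?orbT.
Qed.

(** Column [b] has a descent of value [j + 1] in row [i] iff row [i] exceeds [j] there but not
    [j + 1], and row [i + 1] does not exceed [j]. These columns form the interval from the maximum
    to [row_conj i j]. *)
Lemma row_conjE i j :
  row_conj i j = (des_count i j + maxn (row_conj i.+1 j) (row_conj i j.+1))%N.
Proof.
have ler : (row_conj i.+1 j <= row_conj i j)%N.
  by apply: leq_ltn_imp => b; rewrite !lt_row_conj => /leq_trans; apply.
have lec : (row_conj i j.+1 <= row_conj i j)%N.
  by apply: leq_ltn_imp => b; rewrite !lt_row_conj => /ltnW.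
rewrite (_ : des_count i j = row_conj i j - maxn (row_conj i.+1 j) (row_conj i j.+1))%N.
  by rewrite subnK // geq_max ler lec.
have -> : row_conj i j = minn c (row_conj i j).
  by apply/esym/minn_idPr; rewrite -[leqRHS]card_ord max_card.
rewrite -card_ord_interval; apply: eq_card => b; rewrite !inE.
rewrite geq_max !(leqNgt _ b) !lt_row_conj; have := p_row i b; lia.
Qed.

End Descents.

(** * The bijection between plane partitions and matrices *)

Section Bijection.

Variables (n c m N : nat).

(** The bound [N] makes the matrices a finite type; for [c <= N] no count is truncated, as a row has
    at most [c] descents. *)
Definition matrix_of_pp (p : array n c m) : array n m N :=
  array_of n m N (des_count p).

Definition pp_of_matrix (w : array n m N) : array n c m :=
  array_of n c m (fun i b => #|[set j : 'I_m | (b < lpp w i j)%N]|).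

Lemma lt_entry_pp w i b j :
  (j < entry (pp_of_matrix w) i b)%N = (b < c)%N && (b < lpp w i j)%N.
Proof.
rewrite entry_array_of; last by rewrite -[leqRHS]card_ord max_card.
case: (ltnP i n) => i_n; last by rewrite lpp_out ?i_n // andbF.
case: (ltnP b c) => //= bc.
rewrite (@card_downset m (fun j => (b < lpp w i j)%N)).
  by case: ltnP => // mj; rewrite lpp_out ?mj ?orbT.
by move=> k /leq_trans; apply; apply: lpp_colS.
Qed.

Lemma pp_of_matrix_row w i j :
  (entry (pp_of_matrix w) i.+1 j <= entry (pp_of_matrix w) i j)%N.
Proof.
apply: leq_ltn_imp => k; rewrite !lt_entry_pp => /andP[-> /leq_trans]; apply.
exact: lpp_rowS.
Qed.

Lemma pp_of_matrix_col w i j :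
  (entry (pp_of_matrix w) i j.+1 <= entry (pp_of_matrix w) i j)%N.
Proof.
by apply: leq_ltn_imp => k; rewrite !lt_entry_pp => /andP[/ltnW-> /ltnW].
Qed.

(** Conjugating twice is the identity once [c] columns have room for the longest row, of length
    [lpp w 0 0]. *)
Lemma row_conj_pp_of_matrix w : (lpp w 0 0 <= c)%N ->
  row_conj (pp_of_matrix w) =2 lpp w.
Proof.
move=> w_c i j; apply: eqn_ltn_ext => b.
rewrite (lt_row_conj (pp_of_matrix_col w)) lt_entry_pp; apply: andb_idl => lt_b.
exact: leq_trans lt_b (leq_trans (lpp_le00 w i j) w_c).
Qed.

Hypothesis c_le_N : (c <= N)%N.

Lemma entry_matrix_of_pp p : entry (matrix_of_pp p) =2 des_count p.
Proof.
move=> i j; rewrite entry_array_of ?(leq_trans (des_count_le p i j)) //.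
by case: ifP => // /negbT ij; rewrite des_count_out //; lia.
Qed.

(** The recursions [lppE] and [row_conjE] have equal left-hand sides and equal maxima, so the
    remaining terms agree. *)
Lemma matrix_of_ppK w :
  (lpp w 0 0 <= c)%N -> matrix_of_pp (pp_of_matrix w) = w.
Proof.
move=> w_c; apply: entry_inj => i j; rewrite entry_matrix_of_pp.
have := row_conjE (pp_of_matrix_row w) (pp_of_matrix_col w) i j.
by rewrite !row_conj_pp_of_matrix // [LHS]lppE => /addIn.
Qed.

Variable p : array n c m.
Hypothesis p_row : forall i j, (entry p i.+1 j <= entry p i j)%N.
Hypothesis p_col : forall i j, (entry p i j.+1 <= entry p i j)%N.

Lemma lpp_matrix_of_pp : lpp (matrix_of_pp p) =2 row_conj p.
Proof.
move=> i j; apply/esym; move: i j; apply: lpp_unique => i j.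
  move=> ij; apply: eq_card0 => b; rewrite !inE; apply/negbTE; rewrite -leqNgt.
  by case/orP: ij => ij; [rewrite entry_out ?ij | apply: leq_trans ij; apply: entry_le].
by move=> _ _; rewrite entry_matrix_of_pp row_conjE.
Qed.

Lemma pp_of_matrixK : pp_of_matrix (matrix_of_pp p) = p.
Proof.
apply: entry_inj => i b.
apply: eqn_ltn_ext => j; rewrite lt_entry_pp lpp_matrix_of_pp lt_row_conj //.
by apply: andb_idl; case: (ltnP b c) => // cb; rewrite entry_out ?cb ?orbT.
Qed.

End Bijection.

(** * The shape attached to a matrix *)

(** Row [i] of the plane partition has [lpp w i 0] positive entries. The decreasing column is cut at
    its first zero because partitions have no zero parts. *)
Definition lpp_shape (n m N : nat) (w : array n m N) : seq nat :=
  mkseq (lpp w ^~ 0%N) (find (fun i => lpp w i 0%N == 0%N) (iota 0 n)).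

Section Shape.

Variables (n m N : nat) (w : array n m N).

Lemma nth_lpp_shape i : nth 0%N (lpp_shape w) i = lpp w i 0.
Proof.
rewrite /lpp_shape; set k := find _ _.
case: (ltnP i k) => ik; first by rewrite nth_mkseq.
rewrite nth_default ?size_mkseq //; apply/esym/eqP; rewrite -leqn0.
have k_n : (k <= n)%N by rewrite -[leqRHS](size_iota 0) find_size.
apply: (@leq_trans (lpp w k 0)).
  move: ik => /subnK <-; elim: (i - k)%N => // d IH.
  exact: leq_trans (lpp_rowS w _ _) IH.
move: k_n; rewrite leq_eqVlt => /predU1P[->|k_n].
  by rewrite lpp_out ?leqnn.
have hk : has (fun i => lpp w i 0%N == 0%N) (iota 0 n) by rewrite has_find size_iota.
by have := nth_find 0%N hk; rewrite -/k nth_iota // add0n => /eqP->.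
Qed.

Lemma size_lpp_shape : (size (lpp_shape w) <= n)%N.
Proof. by rewrite size_mkseq -[leqRHS](size_iota 0) find_size. Qed.

Lemma lpp_shape_partition : is_partition (lpp_shape w).
Proof.
apply/andP; split.
  by apply/(sortedP 0%N) => i _; rewrite !nth_lpp_shape; apply: lpp_rowS.
apply/negP => /(nthP 0%N)[i lt_i].
rewrite nth_lpp_shape => Ei.
rewrite size_mkseq in lt_i; have := before_find 0%N lt_i.
rewrite nth_iota ?add0n ?Ei //; apply: leq_trans lt_i _.
by rewrite -[leqRHS](size_iota 0) find_size.
Qed.

End Shape.

Lemma partition_ext (la mu : seq nat) :
  is_partition la -> is_partition mu -> nth 0%N la =1 nth 0%N mu -> la = mu.
Proof.
move=> Pla Pmu E.
apply: (@eq_from_nth _ 0%N) => [|i _]; last exact: E.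
apply: eqn_ltn_ext => i.
by rewrite -[LHS](Defs.part_gt0 _ Pla) -[RHS](Defs.part_gt0 _ Pmu) E.
Qed.

(** This is the side condition of the reindexing in [mcoeff_g_xz]: it singles out the matrices that
    correspond to the shape [la]. *)
Lemma pp_of_matrix_shape (n m N : nat) (la : seq nat) (w : array n m N) :
  (0 < m)%N -> is_partition la -> (size la <= n)%N -> (head 0%N la <= N)%N ->
  pp_of_shape la (pp_of_matrix (head 0%N la) w)
    && (matrix_of_pp N (pp_of_matrix (head 0%N la) w) == w)
  = (la == lpp_shape w).
Proof.
move=> m_gt0 Pla la_n la_N; set p := pp_of_matrix _ w.
apply/andP/eqP => [[/(pp_of_shapeP _ Pla)[[p_row p_col _] p_la] /eqP Ew] | Ela].
  apply: partition_ext (lpp_shape_partition w) _ => // i.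
  rewrite nth_lpp_shape -Ew lpp_matrix_of_pp //.
  by apply: eqn_ltn_ext => b; rewrite lt_row_conj.
have w00 : (lpp w 0 0 <= head 0 la)%N by rewrite -nth0 Ela nth_lpp_shape.
split; last by rewrite matrix_of_ppK.
apply/pp_of_shapeP => //; split; [split|].
- exact: pp_of_matrix_row.
- exact: pp_of_matrix_col.
- exists (maxn n (head 0%N la)) => i j h; apply: entry_out; lia.
move=> i j; rewrite lt_entry_pp Ela nth_lpp_shape -Ela.
by apply: andb_idl => /leq_trans; apply; apply: leq_trans w00; apply: lpp_le00.
Qed.

(** * Descents sorted by row and value *)

(** A descent has a positive value, hence value [j + 1] for a unique [j]. The general law [op]
    serves both products of weights and counts. *)
Lemma big_descents_row (R : Type) (idx : R) (op : Monoid.com_law idx)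
    (n c m : nat) (p : array n c m) (i : 'I_n) (F : 'I_c -> 'I_m.+1 -> R) :
  \big[op/idx]_(b < c | (entry p i.+1 b < entry p i b)%N) F b (p (i, b))
  = \big[op/idx]_(j < m)
      \big[op/idx]_(b < c | (entry p i b == j.+1) && (entry p i.+1 b < j.+1)%N)
        F b (lift ord0 j).
Proof.
rewrite [RHS](exchange_big_dep
  (fun b : 'I_c => (entry p i.+1 b < entry p i b)%N)) /=.
  apply: eq_bigr => b; rewrite entryE => des_b.
  have [j Ej|E0] := unliftP ord0 (p (i, b)); last by rewrite E0 in des_b.
  rewrite Ej in des_b *; rewrite (big_pred1 j) // => k.
  rewrite lift0 eqSS; apply/andP/eqP => [[/eqP jk _]|->].
    exact/val_inj/esym.
  by split.
by move=> j b _ /andP[/eqP-> ].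
Qed.

Lemma row_descentsE (n c m : nat) (p : array n c m) (i : 'I_n) :
  row_descents p i = (\sum_(j < m) des_count p i j)%N.
Proof.
rewrite /row_descents -sum1dep_card (big_descents_row _ _ _ (fun _ _ => 1%N)).
by apply: eq_bigr => j _; rewrite sum1dep_card.
Qed.

(** With the sums exchanged, each column contributes 1 or 0: equal entries of a column are
    contiguous, and only the lowest is a descent. *)
Lemma cols_containingE (n c m : nat) (p : array n c m) (j : 'I_m) :
  (forall i b, (entry p i.+1 b <= entry p i b)%N) ->
  cols_containing p j = (\sum_(i < n) des_count p i j)%N.
Proof.
move=> p_row; rewrite /cols_containing -sum1dep_card /des_count.
under [RHS]eq_bigr => i _ do rewrite -sum1dep_card big_mkcond.
rewrite exchange_big [LHS]big_mkcond; apply: eq_bigr => b _ /=.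
have p_le i k : (i <= k)%N -> (entry p k b <= entry p i b)%N.
  by move=> /subnK <-; elim: (k - i)%N => // d; exact: leq_trans (p_row _ _).
case: existsP => [[a0 /eqP Ea0]|no_j]; last first.
  rewrite big1 // => i _; case: ifP => // /andP[Ei _]; case: no_j.
  by exists i; rewrite -entryE.
(* The bottommost entry [j + 1] of a column is its only such descent. *)
pose P (i : 'I_n) := p (i, b) == j.+1 :> nat.
have [a /eqP Ea a_max] := @arg_maxnP _ a0 P val (introT eqP Ea0).
rewrite (bigD1 a) //= big1 => [|i ne_ia].
  rewrite addn0 entryE Ea eqxx /= ltn_neqAle -[X in (_ <= X)%N]Ea -entryE p_row.
  rewrite andbT; case: eqP => // Ea1; have an : (a.+1 < n)%N.
    by rewrite ltnNge; apply/negP => h; rewrite entry_out ?h in Ea1.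
  have := a_max (Ordinal an); rewrite /P -entryE Ea1 eqxx => /(_ isT) /=.
  by rewrite /val /= ltnn.
case: ifP => // /andP[/eqP Ei lt_i].
case: (ltngtP i a) => [lt_ia|lt_ai|/val_inj E].
- by have := p_le _ _ lt_ia; rewrite entryE Ea leqNgt lt_i.
- by have := a_max i; rewrite /P -entryE Ei eqxx => /(_ isT) /=; rewrite leqNgt lt_ai.
- by rewrite E eqxx in ne_ia.
Qed.

Lemma sum_neq0_exists (V : nmodType) (I : finType) (P : pred I) (F : I -> V) :
  \sum_(i | P i) F i != 0 -> exists2 i, P i & F i != 0.
Proof.
move=> nz; apply/exists_inP; apply: contraNT nz; rewrite negb_exists_in.
by move=> /forall_inP H; rewrite big1 // => i /H /negPn/eqP.
Qed.

(** * Weights as monomials *)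

Section Weight.

Variables n m : nat.

Definition weight (f : nat -> nat -> nat) : {mpoly int[n + m]} :=
  \prod_(i < n) \prod_(j < m) (xvar m i * zvar n j) ^+ f i j.

Definition weight_mon (f : nat -> nat -> nat) : 'X_{1..n + m} :=
  [multinom match split k with
            | inl i => \sum_(j < m) f i j
            | inr j => \sum_(i < n) f i j
            end%N | k < n + m].

Lemma weight_mon_l f i : weight_mon f (lshift m i) = (\sum_(j < m) f i j)%N.
Proof.
rewrite mnmE; case: split_ordP => k /eqP; rewrite ?eq_lrshift //.
by rewrite (inj_eq (@lshift_inj _ _)) => /eqP->.
Qed.

Lemma weight_mon_r f j : weight_mon f (rshift n j) = (\sum_(i < n) f i j)%N.
Proof.
rewrite mnmE; case: split_ordP => k /eqP; rewrite ?eq_rlshift //.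
by rewrite (inj_eq (@rshift_inj _ _)) => /eqP->.
Qed.

Lemma weight_split f :
  weight f = (\prod_(i < n) xvar m i ^+ (\sum_(j < m) f i j)%N)
             * (\prod_(j < m) zvar n j ^+ (\sum_(i < n) f i j)%N).
Proof.
rewrite /weight; under eq_bigr => i _.
  under eq_bigr do rewrite exprMn.
  rewrite big_split /= -expr_sum; over.
rewrite big_split /= exchange_big /=; congr (_ * _).
by apply: eq_bigr => j _; rewrite -expr_sum.
Qed.

Lemma weightE f : weight f = 'X_[weight_mon f].
Proof.
rewrite weight_split mpolyXE_id big_split_ord /=.
by congr (_ * _); apply: eq_bigr => i _; rewrite ?weight_mon_l ?weight_mon_r.
Qed.

Lemma mdeg_weight_mon f :
  mdeg (weight_mon f) = (2 * \sum_(i < n) \sum_(j < m) f i j)%N.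
Proof.
rewrite mdegE big_split_ord /= (eq_bigr _ (fun i _ => weight_mon_l f i)).
rewrite [X in (_ + X)%N](eq_bigr _ (fun j _ => weight_mon_r f j)).
by rewrite [X in (_ + X)%N]exchange_big addnn mul2n.
Qed.

Lemma mcoeff_weight_neq0 f mon : (weight f)@_mon != 0 -> mon = weight_mon f.
Proof.
rewrite weightE mcoeffX.
by case: (weight_mon f =P mon) => [<- _|_] //; rewrite eqxx.
Qed.

Lemma eq_weight (f g : nat -> nat -> nat) :
  (forall (i : 'I_n) (j : 'I_m), f i j = g i j) ->
  weight f = weight g.
Proof. by move=> fg; do 2![apply: eq_bigr => ? _]; rewrite fg. Qed.

Lemma prod_descents c (p : array n c m) :
  \prod_(u in Des p) (xvar m u.1 * zentry n (p u)) = weight (des_count p).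
Proof.
rewrite (eq_bigl (fun u : 'I_n * 'I_c =>
  true && (entry p u.1.+1 u.2 < entry p u.1 u.2)%N)); last by move=> u; rewrite inE.
rewrite (eq_bigr (fun u : 'I_n * 'I_c =>
  xvar m u.1 * zentry n (p (u.1, u.2)))); last by case.
rewrite -(pair_big_dep xpredT
  (fun (i : 'I_n) (b : 'I_c) => (entry p i.+1 b < entry p i b)%N)
  (fun i b => xvar m i * zentry n (p (i, b)))) /=.
apply: eq_bigr => i _.
rewrite (big_descents_row _ p i (fun _ v => xvar m i * zentry n v)).
apply: eq_bigr => j _; rewrite /zentry liftK prodr_const.
by congr (_ ^+ _); apply: eq_card => b; rewrite !inE.
Qed.

Lemma g_xzE la : g_xz n m la
  = \sum_(p : array n (head 0%N la) m | pp_of_shape la p) weight (des_count p).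
Proof. by apply: eq_bigr => p _; rewrite prod_descents. Qed.

Lemma mcoeff_g_xz_neq0 la mon : (g_xz n m la)@_mon != 0 ->
  exists2 p : array n (head 0%N la) m,
    pp_of_shape la p & mon = weight_mon (des_count p).
Proof.
rewrite g_xzE raddf_sum /= => /sum_neq0_exists[p Sp /mcoeff_weight_neq0->].
by exists p.
Qed.

End Weight.

(** * Coefficients of the sum over all shapes *)

Section Cauchy.

Variables n m : nat.
Hypothesis m_gt0 : (0 < m)%N.

(** One bound [N] serves all shapes with first part at most [N], so that their sums can be merged
    over a common set of matrices. *)
Lemma mcoeff_g_xz N la mon :
  is_partition la -> (size la <= n)%N -> (head 0%N la <= N)%N ->
  (g_xz n m la)@_mon =
    \sum_(w : array n m N | la == lpp_shape w) (weight n m (entry w))@_mon.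
Proof.
move=> Pla la_n la_N; rewrite g_xzE raddf_sum /=.
rewrite (reindex_onto (@pp_of_matrix n (head 0%N la) m N)
                      (@matrix_of_pp n (head 0%N la) m N)) /=.
  apply: eq_big => [w|w]; first by rewrite pp_of_matrix_shape.
  rewrite pp_of_matrix_shape // => /eqP Ela; congr (_@_mon); apply: eq_weight => i j.
  by rewrite -(entry_matrix_of_pp la_N) matrix_of_ppK // -nth0 Ela nth_lpp_shape.
by move=> p /(pp_of_shapeP _ Pla)[[p_row p_col _] _]; apply: pp_of_matrixK.
Qed.

(** A last passage time is at most the total of the matrix, which is half the degree of its
    monomial. Only finitely many shapes thus contribute to [mon]. *)
Lemma lpp_le_mdeg N (w : array n m N) mon :
  (weight n m (entry w))@_mon != 0 -> (lpp w 0 0 <= mdeg mon)%N.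
Proof.
move=> /mcoeff_weight_neq0->; rewrite mdeg_weight_mon pair_bigA /=.
rewrite (eq_bigr (fun u => w u : nat)).
  by rewrite mul2n -addnn (leq_trans (lpp_le_sum w 0 0)) ?leq_addl.
by case=> i j _; rewrite entryE.
Qed.

Lemma mcoeff_g_xz_shape N la mon :
  is_partition la -> (size la <= n)%N -> (head 0%N la <= N)%N ->
  (g_xz n m la)@_mon != 0 ->
  exists2 w : array n m N, la = lpp_shape w & (lpp w 0 0 <= mdeg mon)%N.
Proof.
move=> Pla la_n la_N; rewrite (mcoeff_g_xz _ Pla la_n la_N).
move=> /sum_neq0_exists[w /eqP Ew wN].
by exists w => //; apply: lpp_le_mdeg.
Qed.

Lemma sum_mcoeff_g_xz mon : exists s : seq (seq nat),
  [/\ uniq s, all (fun la => is_partition la && (size la <= n)%N) s,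
      forall la, is_partition la && (size la <= n)%N ->
        (g_xz n m la)@_mon != 0 -> la \in s
    & \sum_(w : array n m (mdeg mon)) (weight n m (entry w))@_mon
      = \sum_(la <- s) (g_xz n m la)@_mon].
Proof.
set N := mdeg mon.
pose s := undup [seq lpp_shape w | w <- enum {: array n m N} & (lpp w 0 0 <= N)%N].
have mem_s la : reflect (exists2 w : array n m N, la = lpp_shape w & (lpp w 0 0 <= N)%N)
    (la \in s).
  rewrite mem_undup; apply: (iffP mapP) => [[w]|[w Ew wN]].
    by rewrite mem_filter => /andP[wN _] ->; exists w.
  by exists w => //; rewrite mem_filter wN mem_enum.
exists s; split; first exact: undup_uniq.
- by apply/allP => la /mem_s[w -> _]; rewrite lpp_shape_partition size_lpp_shape.
- move=> la /andP[Pla la_n] nz; apply/mem_s.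
  (* Matrices bounded by the first part of [la] show that this part is at most [N]; the lemma then
     applies again with the bound [N]. *)
  have [w Ew wN] := mcoeff_g_xz_shape Pla la_n (leqnn _) nz.
  by apply: mcoeff_g_xz_shape nz => //; rewrite -nth0 Ew nth_lpp_shape.
have -> : \sum_(la <- s) (g_xz n m la)@_mon = \sum_(la <- s)
    \sum_(w : array n m N | la == lpp_shape w) (weight n m (entry w))@_mon.
  apply: eq_big_seq => la /mem_s[w -> wN].
  rewrite (@mcoeff_g_xz N) ?lpp_shape_partition ?size_lpp_shape //.
  by rewrite -nth0 nth_lpp_shape.
rewrite (exchange_big_dep xpredT) //=; apply: eq_bigr => w _.
rewrite -big_filter; case: (boolP (lpp_shape w \in s)) => [w_s|w_s].
  by rewrite filter_pred1_uniq ?undup_uniq // big_seq1.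
rewrite (eq_in_filter (a2 := pred0)) ?filter_pred0 ?big_nil; last first.
  by move=> la la_s /=; apply: contraNF w_s => /eqP <-.
(* A matrix whose shape is missing from [s] has [lpp w 0 0] above the degree, so its weight is not
   [mon]. *)
by apply: contraNeq w_s => /lpp_le_mdeg wN; apply/mem_s; exists w.
Qed.

End Cauchy.

(** * Power series up to a given degree, and the product side *)

Section TruncatedSeries.

Variable k : nat.
Implicit Types (f g : fps k) (p q : {mpoly int[k]}).

(** Replaces series by polynomials, where distributivity over big operators is at hand. *)
Definition eq_upto (N : nat) f p : Prop :=
  forall mon, (mdeg mon <= N)%N -> f mon = p@_mon.

Lemma eq_upto_one N : eq_upto N (fps_one k) 1.
Proof. by move=> mon _; rewrite mcoeff1. Qed.

Lemma eq_upto_mul N f g p q :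
  eq_upto N f p -> eq_upto N g q -> eq_upto N (fps_mul f g) (p * q).
Proof.
move=> fp gq mon le_N; rewrite mcoeffM; apply: eq_bigr => u _.
by rewrite fp ?gq // -ltnS (leq_trans (bmdeg _)).
Qed.

Lemma eq_upto_prod N (I : finType) (F : I -> fps k) (P : I -> {mpoly int[k]}) :
  (forall i, eq_upto N (F i) (P i)) ->
  eq_upto N (\big[@fps_mul k/fps_one k]_i F i) (\prod_i P i).
Proof.
move=> FP; elim/big_rec2: _ => [|i p f _ IH]; first exact: eq_upto_one.
exact: eq_upto_mul.
Qed.

Lemma eq_upto_inv N p : p@_0%MM = 0 ->
  eq_upto N (fps_inv (fps_of (1 - p))) (\sum_(e < N.+1) p ^+ e).
Proof.
move=> p0 mon le_N; set t := fps_sub (fps_one k) (fps_of (1 - p)).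
have tE M : eq_upto M t p.
  by move=> v _; rewrite /t /fps_sub /fps_of mcoeffB mcoeff1 opprB addrC subrK.
have exptE e : fps_exp t e mon = (p ^+ e)@_mon.
  suff: eq_upto (mdeg mon) (fps_exp t e) (p ^+ e) by apply.
  elim: e => [|e IH]; first by rewrite expr0; apply: eq_upto_one.
  by rewrite exprS; apply: eq_upto_mul.
rewrite raddf_sum /= /fps_inv -/t.
rewrite -!(big_mkord xpredT (fun e => fps_exp t e mon)).
rewrite -(big_mkord xpredT (fun e => (p ^+ e)@_mon)).
(* The powers beyond [mdeg mon] do not contain [mon], since [p] has no constant term. *)
rewrite [RHS](big_cat_nat (n := (mdeg mon).+1)) //=.
rewrite [X in _ = _ + X]big_nat_cond [X in _ = _ + X]big1 ?addr0 => [|e].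
  by apply: eq_bigr => e _; rewrite exptE.
by case/andP=> /andP[le_e _] _; rewrite -exptE fps_exp_low // (tE 0%N) ?mdeg0.
Qed.

End TruncatedSeries.

Lemma cauchy_product_mcoeff n m mon :
  (\big[@fps_mul (n + m)/fps_one (n + m)]_(i < n)
     \big[@fps_mul (n + m)/fps_one (n + m)]_(j < m)
       fps_inv (fps_of (1 - xvar m i * zvar n j))) mon
  = \sum_(w : array n m (mdeg mon)) (weight n m (entry w))@_mon.
Proof.
set N := mdeg mon.
rewrite (@eq_upto_prod _ N _ _ (fun i => \prod_(j < m)
   \sum_(e < N.+1) (xvar m i * zvar n j) ^+ e)) //; last first.
  move=> i; apply: eq_upto_prod => j; apply: eq_upto_inv.
  rewrite /xvar /zvar -mpolyXD mcoeffX; case: eqP => // /(congr1 (@mdeg _)).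
  by rewrite mdegD !mdeg1 mdeg0.
(* Expanding the product chooses an exponent at most [N] for each pair [(i, j)]: the choices are
   exactly the matrices of type [array n m N]. *)
rewrite pair_bigA /= bigA_distr_bigA raddf_sum /=; apply: eq_bigr => w _.
congr (_@_mon); rewrite /weight pair_bigA /=; apply: eq_bigr => -[i j] _ /=.
by rewrite entryE.
Qed.

(** * Changing the number of rows of the box *)

Section Resize.

Variables (la : seq nat) (r r' c m : nat).
Hypothesis Pla : is_partition la.
Hypotheses (la_r : (size la <= r)%N) (la_r' : (size la <= r')%N).

Lemma plane_partition_ext (p q : nat -> nat -> nat) :
  p =2 q -> plane_partition p -> plane_partition q.
Proof.
move=> pq [p1 p2 [N pN]]; split=> [i j|i j|]; rewrite -?pq //.
by exists N => i j h; rewrite -pq pN.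
Qed.

Lemma pp_of_shape_ext (p : array r c m) (q : array r' c m) :
  entry p =2 entry q -> pp_of_shape la p -> pp_of_shape la q.
Proof.
move=> pq /(pp_of_shapeP _ Pla)[Pp Sp]; apply/pp_of_shapeP => //; split.
  exact: plane_partition_ext Pp.
by move=> i j; rewrite -pq.
Qed.

Lemma entry_resize (p : array r c m) : pp_of_shape la p ->
  entry (array_of r' c m (entry p)) =2 entry p.
Proof.
move=> /(pp_of_shapeP _ Pla)[_ Sp] i j; rewrite entry_array_of ?entry_le //.
case: ifP => // /negbT ij; apply/esym/eqP; rewrite -leqn0 leqNgt Sp -leqNgt.
case: (ltnP i r') ij => /= [_|i_r' _]; last first.
  by rewrite nth_default // (leq_trans la_r').
rewrite -leqNgt => cj; rewrite leqNgt -Sp entry_out ?cj ?orbT //.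
Qed.

End Resize.

(** Needed because [g_xz] uses [n] rows while [schur] and [dual_grothendieck] use [size la]; padding
    or cropping by zero rows is a bijection. *)
Lemma sum_resize (V : nmodType) (la : seq nat) (r r' c m : nat)
    (Q : pred (array r c m)) (Q' : pred (array r' c m))
    (F : array r c m -> V) (F' : array r' c m -> V) :
  is_partition la -> (size la <= r)%N -> (size la <= r')%N ->
  (forall p q, entry p =2 entry q -> Q p = Q' q) ->
  (forall p q, entry p =2 entry q -> pp_of_shape la p -> F p = F' q) ->
  \sum_(p | pp_of_shape la p && Q p) F p
  = \sum_(q | pp_of_shape la q && Q' q) F' q.
Proof.
move=> Pla la_r la_r' QQ' FF'.
rewrite (reindex_onto (fun q : array r' c m => array_of r c m (entry q))
  (fun p : array r c m => array_of r' c m (entry p))) /=; last first.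
  move=> p /andP[Sp _]; apply: entry_inj => i j.
  have E := entry_resize Pla la_r' Sp.
  rewrite -[RHS]E; apply: (entry_resize Pla la_r).
  by apply: pp_of_shape_ext Sp => // a b; rewrite E.
have shapeE q : pp_of_shape la q ->
    array_of r' c m (entry (array_of r c m (entry q))) = q.
  move=> Sq; have E := entry_resize Pla la_r Sq.
  apply: entry_inj => i j; rewrite (entry_resize Pla la_r') //.
  by apply: pp_of_shape_ext Sq => // a b; rewrite E.
apply: eq_big => [q|q].
  apply/idP/idP => [/andP[/andP[Sp Qp] /eqP Eq]|/andP[Sq Qq]].
    have E := entry_resize Pla la_r' Sp; rewrite Eq in E.
    by rewrite -(QQ' (array_of r c m (entry q))) // Qp (pp_of_shape_ext Pla _ Sp).
  have E := entry_resize Pla la_r Sq.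
  rewrite shapeE // eqxx andbT (QQ' _ q) // Qq andbT.
  by apply: pp_of_shape_ext Sq => // a b; rewrite E.
move=> /andP[/andP[Sp Qp] /eqP Eq]; apply: FF' => //.
by have E := entry_resize Pla la_r' Sp; rewrite Eq in E => i j; rewrite E.
Qed.

Lemma eq_cols_containing (r r' c m : nat) (p : array r c m) (q : array r' c m) k :
  entry p =2 entry q -> cols_containing p k = cols_containing q k.
Proof.
suff sub s s' (a : array s c m) (b : array s' c m) x : entry a =2 entry b ->
    [exists i : 'I_s, a (i, x) == k.+1 :> nat] ->
    [exists i : 'I_s', b (i, x) == k.+1 :> nat].
  by move=> pq; apply: eq_card => x; rewrite !inE; apply/idP/idP; apply: sub.
move=> ab /existsP[i]; rewrite -entryE ab => /eqP Ei.
have lt_i : (i < s')%N by rewrite ltnNge; apply/negP => h; rewrite entry_out ?h in Ei.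
by apply/existsP; exists (Ordinal lt_i); rewrite -entryE Ei.
Qed.

(** * Column-strictness and the top-degree part *)

Lemma column_strictP (r c m : nat) (p : array r c m) :
  reflect (forall i j, (0 < entry p i j)%N -> (entry p i.+1 j < entry p i j)%N)
          (column_strict p).
Proof.
apply: (iffP forallP) => [H i j|H a]; last by apply/forallP => b; apply/implyP/H.
case: (ltnP i r) => i_r; last by rewrite entry_out ?i_r.
case: (ltnP j c) => j_c; last by rewrite entry_out ?j_c ?orbT.
by move/forallP/(_ (Ordinal j_c))/implyP: (H (Ordinal i_r)).
Qed.

(** A strictly decreasing column contains each value at most once, so projecting cells to their
    columns is injective. *)
Lemma mult_entry_column_strict (r c m : nat) (p : array r c m) k :
  (forall i b, (entry p i.+1 b <= entry p i b)%N) -> column_strict p ->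
  mult_entry p k = cols_containing p k.
Proof.
move=> p_row /column_strictP p_cs.
have p_lt i i' b : (i < i')%N -> (0 < entry p i b)%N -> (entry p i' b < entry p i b)%N.
  move=> /subnK <- /p_cs; elim: (i' - i.+1)%N => // d IH /IH.
  exact: leq_ltn_trans (p_row _ _).
rewrite /mult_entry -(@card_in_imset _ _ snd) => [|[a b] [a' b']]; last first.
  rewrite !inE /= => /eqP Ea /eqP Ea' Eb; rewrite -{}Eb in Ea' *.
  rewrite -entryE in Ea; rewrite -entryE in Ea'.
  case: (ltngtP a a') => [lt_a|lt_a|/val_inj-> //].
    by have := p_lt _ _ b lt_a; rewrite Ea Ea' ltnn => /(_ isT).
  by have := p_lt _ _ b lt_a; rewrite Ea Ea' ltnn => /(_ isT).
apply: eq_card => b; rewrite inE; apply/imsetP/existsP => [[[a b'] + ->]|[a Ea]].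
  by rewrite inE; exists a.
by exists (a, b); rewrite ?inE.
Qed.

Lemma sumn_partition n la : (size la <= n)%N ->
  sumn la = (\sum_(i < n) nth 0 la i)%N.
Proof.
move=> la_n; rewrite sumnE (big_nth 0%N) big_mkord (big_ord_widen n (nth 0%N la)) //.
by rewrite big_mkcond; apply: eq_bigr => i _; case: ltnP => // h; rewrite nth_default.
Qed.

Section Rows.

Variables (la : seq nat) (n c m : nat) (p : array n c m).
Hypotheses (Pla : is_partition la) (Sp : pp_of_shape la p).

Lemma card_row_shape i : #|[set b : 'I_c | (0 < entry p i b)%N]| = nth 0%N la i.
Proof.
have /(pp_of_shapeP _ Pla)[[_ p_col _] pS] := Sp.
by apply: eqn_ltn_ext => b; rewrite (lt_row_conj p_col) pS.
Qed.

Lemma row_descents_le (i : 'I_n) : (row_descents p i <= nth 0 la i)%N.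
Proof.
rewrite -card_row_shape; apply/subset_leq_card/subsetP => b.
by rewrite !inE; apply: leq_ltn_trans.
Qed.

Lemma row_descents_column_strict (i : 'I_n) :
  column_strict p -> row_descents p i = nth 0%N la i.
Proof.
move=> /column_strictP p_cs; apply/eqP; rewrite eqn_leq row_descents_le /=.
rewrite -card_row_shape; apply/subset_leq_card/subsetP => b.
by rewrite !inE; apply: p_cs.
Qed.

(** Some cell of the shape is not a descent, so its row has fewer descents than cells. *)
Lemma sum_row_descents_lt : (size la <= n)%N -> ~~ column_strict p ->
  (\sum_(i < n) row_descents p i < sumn la)%N.
Proof.
move=> la_n; rewrite (sumn_partition la_n) => /forallPn[a /forallPn[b]].
rewrite negb_imply => /andP[pos_ab ndes_ab].
rewrite (bigD1 a) //= [ltnRHS](bigD1 a) //= -addSn leq_add //.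
  rewrite -card_row_shape; apply: proper_card; apply/properP; split.
    by apply/subsetP => x; rewrite !inE; apply: leq_ltn_trans.
  by exists b; rewrite !inE.
by apply: leq_sum => i _; apply: row_descents_le.
Qed.

Lemma weight_des_count :
  weight n m (des_count p)
  = (\prod_(i < n) xvar m i ^+ row_descents p i)
    * (\prod_(j < m) zvar n j ^+ cols_containing p j).
Proof.
have /(pp_of_shapeP _ Pla)[[p_row _ _] _] := Sp.
rewrite weight_split; congr (_ * _); apply: eq_bigr => i _.
  by rewrite row_descentsE.
by rewrite cols_containingE.
Qed.

End Rows.

(** In a column-strict plane partition every cell is a descent, so the x-part is constant and
    factors out. *)
Lemma g_xz_top n m la : is_partition la -> (size la <= n)%N ->
  (\prod_(i < n) xvar m i ^+ nth 0%N la i) * in_z n (schur m la)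
  = \sum_(p : array n (head 0%N la) m | pp_of_shape la p && column_strict p)
      weight n m (des_count p).
Proof.
move=> Pla la_n; rewrite /in_z /schur raddf_sum mulr_sumr /=.
under [RHS]eq_bigr => p /andP[Sp cs].
  rewrite (weight_des_count Pla Sp).
  under eq_bigr => i _ do rewrite (row_descents_column_strict Pla Sp) //.
  over.
apply/esym.
rewrite (sum_resize (r' := size la) (Q' := @column_strict _ _ _) (F' := fun q =>
   (\prod_(i < n) xvar m i ^+ nth 0%N la i)
   * \prod_(j < m) zvar n j ^+ cols_containing q j)) // => [|p q pq|p q pq _].
- apply: eq_bigr => q /andP[/(pp_of_shapeP _ Pla)[[q_row _ _] _] cs].
  congr (_ * _); rewrite rmorph_prod; apply: eq_bigr => k _.
  by rewrite rmorphXn /= comp_mpolyXU nth_mktuple mult_entry_column_strict.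
- by apply/column_strictP/column_strictP => cs i j; have := cs i j; rewrite !pq.
by congr (_ * _); apply: eq_bigr => j _; rewrite (eq_cols_containing _ pq).
Qed.

Lemma set_x_1_weight n m f :
  set_x_1 (weight n m f) = \prod_(j < m) 'X_j ^+ (\sum_(i < n) f i j)%N.
Proof.
rewrite /set_x_1 weightE comp_mpolyX big_split_ord /= big1 ?mul1r => [|i _].
  apply: eq_bigr => j _; rewrite weight_mon_r tnth_mktuple.
  by rewrite -[rshift n j]/(unsplit (inr j)) unsplitK.
by rewrite tnth_mktuple -[lshift m i]/(unsplit (inl i)) unsplitK expr1n.
Qed.

Theorem theorem5p2 (n m : nat) (n_gt0 : (0 < n)%N) (m_gt0 : (0 < m)%N) :
  [/\ (* (i) *)
      (forall la : seq nat, is_partition la -> (size la <= n)%N ->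
         exists r : {mpoly int[n + m]},
           g_xz n m la
             = (\prod_(i < n) xvar m i ^+ nth 0%N la i) * in_z n (schur m la) + r
           /\ forall mon, mon \in msupp r -> (mdeg mon < 2 * sumn la)%N)
      /\
      (forall la : seq nat, is_partition la ->
         forall mon, mon \in msupp (g_xz n m la) ->
           (\sum_(i < n) mon (lshift m i) = \sum_(j < m) mon (rshift n j))%N),
      (* (ii) *)
      forall la : seq nat, is_partition la ->
        g_xz n m la
          = \sum_(p : array n (head 0%N la) m | pp_of_shape la p)
              (\prod_(i < n) xvar m i ^+ row_descents p i)
              * (\prod_(j < m) zvar n j ^+ cols_containing p j),
      (* (iii) *)
      forall la : seq nat, is_partition la -> (size la <= n)%N ->
        set_x_1 (g_xz n m la) = dual_grothendieck m la
    & (* (iv) *)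
      fps_is_sum (fun la : seq nat => is_partition la && (size la <= n)%N)
        (fun la => fps_of (g_xz n m la))
        (\big[@fps_mul (n + m)/fps_one (n + m)]_(i < n)
           \big[@fps_mul (n + m)/fps_one (n + m)]_(j < m)
             fps_inv (fps_of (1 - xvar m i * zvar n j)))].
Proof.
split; [split|..].
(* The remainder collects the plane partitions that are not column-strict. The factor 2 in the bound
   arises because each descent contributes one x and one z. *)
- move=> la Pla la_n; exists (\sum_(p : array n (head 0%N la) m
    | pp_of_shape la p && ~~ column_strict p) weight n m (des_count p)).
  rewrite g_xz_top // g_xzE -bigID; split=> // mon.
  rewrite mcoeff_msupp raddf_sum /=.
  move=> /sum_neq0_exists[p /andP[Sp ncs] /mcoeff_weight_neq0->].
  rewrite mdeg_weight_mon ltn_mul2l /=.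
  under eq_bigr do rewrite -row_descentsE.
  exact: sum_row_descents_lt.
- move=> la Pla mon; rewrite mcoeff_msupp => /mcoeff_g_xz_neq0[p _ ->].
  rewrite (eq_bigr _ (fun i _ => weight_mon_l m _ i)) exchange_big.
  by apply/esym/eq_bigr => j _; rewrite weight_mon_r.
- by move=> la Pla; rewrite g_xzE; apply: eq_bigr => p Sp; apply: weight_des_count Sp.
- move=> la Pla la_n; rewrite g_xzE /set_x_1 raddf_sum /= /dual_grothendieck.
  under eq_bigl do rewrite -[pp_of_shape _ _]andbT.
  under [RHS]eq_bigl do rewrite -[pp_of_shape _ _]andbT.
  apply: (sum_resize (Q := xpredT) (Q' := xpredT)) => // p q pq.
  move=> /(pp_of_shapeP _ Pla)[[p_row _ _] _].
  rewrite -[LHS]/(set_x_1 _) set_x_1_weight; apply: eq_bigr => j _.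
  by rewrite -cols_containingE // (eq_cols_containing _ pq).
- move=> mon; have [s [s_uniq s_P s_mem s_sum]] := sum_mcoeff_g_xz m_gt0 mon.
  by exists s; split=> //; rewrite cauchy_product_mcoeff.
Qed.
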